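(* There are $2^{2^{\aleph_0}}$ distinct homeomorphism classes among the spaces $P_A$, $A\subseteq\mathbb{R}$; that is, the set of equivalence classes of the family $\{P_A: A\subseteq\mathbb{R}\}$ under the relation of being homeomorphic has cardinality $2^{2^{\aleph_0}}$.
   Context: The Prüfer plane $P$ is the 2-manifold obtained by adding to the open upper half plane a copy of the closed lower half plane at each point of the $x$-axis. Explicitly: as a set, $P$ is the disjoint union of $U=\{(x,y)\in\mathbb{R}^2: y>0\}$ and, for each $a\in\mathbb{R}$, a copy $L_a=\{(x,y)_a: x\in\mathbb{R},\ y\le 0\}$ of the closed lower half plane. For each $a\in\mathbb{R}$ define an injective map $\Phi_a:\mathbb{R}^2\to P$ by $$\Phi_a(x,y)=\begin{cases}(a+xy,\,y)\in U & \text{if } y>0,\\ (x,y)_a\in L_a & \text{if } y\le 0.\end{cases}$$ The topology of $P$ is the one for which a set $V\subseteq P$ is open if and only if $\Phi_a^{-1}(V)$ is open in $\mathbb{R}^2$ for every $a\in\mathbb{R}$; each $\Phi_a$ is then a homeomorphism onto the open subset $U\cup L_a$ of $P$, and $U$ is open in $P$ with its usual topology. For $A\subseteq\mathbb{R}$, $P_A=U\cup\bigcup_{a\in A}L_a\subseteq P$ with the subspace topology; it is an open subset of $P$. *)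

(* Defs.v *)
From HB Require Import structures.
From mathcomp Require Import all_boot all_order all_algebra.
From mathcomp Require Import all_classical all_reals all_analysis.

Set Implicit Arguments.
Unset Strict Implicit.
Unset Printing Implicit Defensive.

Import Order.TTheory GRing.Theory Num.Theory.
Import numFieldNormedType.Exports.

Local Open Scope classical_set_scope.
Local Open Scope ring_scope.

(* [Upper x y _] is the point (x, y) of U, and [Lower a x y _] is the point
   (x, y)_a of L_a. *)
Inductive prufer (R : realType) : Type :=
| Upper (x y : R) of 0 < y
| Lower (a x y : R) of y <= 0.

HB.instance Definition _ (R : realType) := gen_eqMixin (prufer R).
HB.instance Definition _ (R : realType) := gen_choiceMixin (prufer R).

Definition prufer_chart (R : realType) (a : R) (p : R * R) : prufer R :=
  match ltP 0 p.2 with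
  | Order.LtlNotGe y_gt0 => Upper (a + p.1 * p.2) y_gt0
  | Order.GelNotLt y_le0 => Lower a p.1 y_le0
  end.

Lemma prufer_chart_gt0 (R : realType) (a x y : R) (y_gt0 : 0 < y) :
  prufer_chart a (x, y) = Upper (a + x * y) y_gt0.
Proof.
rewrite /prufer_chart; case: ltP => /= y0; last by have := lt_geF y_gt0; rewrite y0.
by rewrite (bool_irrelevance y0 y_gt0).
Qed.

Lemma prufer_chart_le0 (R : realType) (a x y : R) (y_le0 : y <= 0) :
  prufer_chart a (x, y) = Lower a x y_le0.
Proof.
rewrite /prufer_chart; case: ltP => /= y0; first by have := lt_geF y0; rewrite y_le0.
by rewrite (bool_irrelevance y0 y_le0).
Qed.

Definition prufer_open (R : realType) : set_system (prufer R) :=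
  [set V | forall a : R, open (prufer_chart a @^-1` V)].

Lemma prufer_openT (R : realType) : prufer_open [set: prufer R].
Proof. by move=> a; rewrite preimage_setT; exact: openT. Qed.

Lemma prufer_openI (R : realType) : setI_closed (@prufer_open R).
Proof. by move=> V W oV oW a; rewrite preimage_setI; exact: openI. Qed.

Lemma prufer_open_bigU (R : realType) (I : Type) (V : I -> set (prufer R)) :
  (forall i, prufer_open (V i)) -> prufer_open (\bigcup_i V i).
Proof.
by move=> oV a; rewrite preimage_bigcup; apply: bigcup_open => i _; exact: oV.
Qed.

HB.instance Definition _ (R : realType) :=
  isOpenTopological.Build (prufer R)
    (@prufer_openT R) (@prufer_openI R) (@prufer_open_bigU R).

Definition prufer_U (R : realType) : set (prufer R) :=
  [set p | exists x y (y_gt0 : 0 < y), p = Upper x y_gt0].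

Definition prufer_L (R : realType) (a : R) : set (prufer R) :=
  [set p | exists x y (y_le0 : y <= 0), p = Lower a x y_le0].

Definition prufer_sub (R : realType) (A : set R) : set (prufer R) :=
  @prufer_U R `|` \bigcup_(a in A) prufer_L a.

Definition homeomorphic (X Y : topologicalType) : Prop :=
  exists (f : X -> Y) (g : Y -> X),
    [/\ cancel f g, cancel g f, continuous f & continuous g].

(* The class of P_A in the family, as the set of indices B with P_B homeomorphic
   to P_A.  A subset of a topological space, coerced to a type by [set_type],
   carries the subspace topology. *)
Definition prufer_class (R : realType) (A : set R) : set (set R) :=
  [set B | homeomorphic (prufer_sub A) (prufer_sub B)].

(* Main.v *)
Require Import Defs.
From mathcomp Require Import all_boot all_order all_algebra.
From mathcomp Require Import all_classical all_reals all_analysis.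
From mathcomp Require Import lra.

(** The number of classes is at most the number [2 ^ c] of subsets of the line,
    where [c] is the cardinality of the continuum.  For the lower bound it is
    enough that each class contains at most [c] index sets: then the [2 ^ c]
    index sets cannot be exhausted by fewer than [2 ^ c] classes.

    Fix [A] and a homeomorphism [h : P_A -> P_B].  The upper half plane [U] is
    separable, so there are at most [c] possibilities for the trace of [h] on a
    countable dense subset of [U].  This trace determines [B] up to a countable
    set ([homeomorphic_diff_countable]), and there are only [c] countable
    subsets of the line, so there are at most [c] possibilities for [B]
    ([prufer_class_small]).

    To see that the trace almost determines [B], note that the interiors of the
    lower half planes are disjoint open sets, so a separable space meets only
    countably many of them ([countable_open_lower_half]).  Hence for all but
    countably many [b] in [B] the preimage of the interior of [L_b] meets the
    interior of some [L_a], and that interior has an image avoiding [U].  A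
    vertical segment running up to the boundary of this [L_a] is connected, so its image stays
    in the interior of [L_b], and its upper end point [q] goes to [L_b]
    ([image_boundary]).  If [h' : P_A -> P_B'] has the same trace, the same [a]
    gives [b'] in [B'] with [h' q] in [L_b'].  But [q] lies in the closure of
    [U], on which [h] and [h'] agree, and distinct lower half planes have
    disjoint neighbourhoods ([strip_disjoint]).  So [b = b'] is in [B'].

    That classes of at most [c] elements must be [2 ^ c] in number is a case of
    Koenig's diagonal argument ([konig_diagonal], [small_classes]). *)

Set Implicit Arguments.
Unset Strict Implicit.
Unset Printing Implicit Defensive.

Import Order.TTheory GRing.Theory Num.Theory.
Import numFieldNormedType.Exports.

Local Open Scope classical_set_scope.
Local Open Scope ring_scope.
Local Open Scope card_scope.

(** * Sets of at most continuum cardinality *)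

Lemma injective_card_le (T U : Type) (f : T -> U) :
  injective f -> [set: T] #<= [set: U].
Proof.
move=> f_inj; have : $|{injfun [set: T] >-> [set: U]}|.
  by apply/injfunPex; exists f => // x y _ _; exact: f_inj.
by move=> [g]; exact: inj_card_le g.
Qed.

Lemma card_le_injective (T U : Type) (u : U) :
  [set: T] #<= [set: U] -> exists f : T -> U, injective f.
Proof.
move=> /card_leP[f]; exists (fun x => val (f (SigSub (mem_set (I : [set: T] x))))).
move=> x y /val_inj /(@inj _ _ _ f); rewrite !inE => /(_ I I) /(congr1 val).
exact.
Qed.

Lemma card_powerset_le (T U : Type) (f : T -> U) :
  injective f -> [set: set T] #<= [set: set U].
Proof.
move=> f_inj; apply: (@injective_card_le _ _ (fun X => f @` X)) => X Y eXY.
have fE (Z : set T) x : (f @` Z) (f x) <-> Z x.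
  by split=> [[y Zy /f_inj <-]//|Zx]; exists x.
apply/seteqP; split=> x Zx; apply/fE; first by rewrite -[f @` Y]eXY; apply/fE.
by rewrite [f @` X]eXY; apply/fE.
Qed.

Lemma card_set_countType (T : countType) : [set: set T] #<= [set: set nat].
Proof. exact: card_powerset_le (pcan_inj (@choice.pickleK T)). Qed.

(** Uncurrying turns a [T]-indexed family of subsets of [nat] into one subset of
    the countable type [T * nat]. *)
Lemma card_fun_countType (T : countType) (U : Type) :
  [set: U] #<= [set: set nat] -> [set: T -> U] #<= [set: set nat].
Proof.
move=> /(card_le_injective set0)[f f_inj].
apply: card_le_trans (card_set_countType (T * nat)%type).
apply: (@injective_card_le _ _ (fun g : T -> U => [set z | f (g z.1) z.2])).
move=> g h egh; apply/funext => t; apply: f_inj; apply/funext => n.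
exact: (congr1 (fun X : set (T * nat) => X (t, n)) egh).
Qed.

Lemma card_prod_set_nat (T U : Type) :
  [set: T] #<= [set: set nat] -> [set: U] #<= [set: set nat] ->
  [set: T * U] #<= [set: set nat].
Proof.
move=> /(card_le_injective set0)[f f_inj] /(card_le_injective set0)[g g_inj].
apply: card_le_trans (card_set_countType (nat + nat)%type).
pose h (p : T * U) : set (nat + nat) :=
  [set z | match z with inl n => f p.1 n | inr n => g p.2 n end].
apply: (@injective_card_le _ _ h) => -[t u] [t' u'] e; congr pair.
  by apply: f_inj; apply/funext => n; exact: (congr1 (fun X => X (inl n)) e).
by apply: g_inj; apply/funext => n; exact: (congr1 (fun X => X (inr n)) e).
Qed.

Lemma lt_rat_inj (R : realType) (x y : R) :
  (forall q : rat, ratr q < x <-> ratr q < y) -> x = y.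
Proof.
move=> e; apply/eqP; case: (ltgtP x y) => // /rat_in_itvoo[q].
  by rewrite in_itv /= => /andP[xq /e]; rewrite ltNge (ltW xq).
by rewrite in_itv /= => /andP[yq /e]; rewrite ltNge (ltW yq).
Qed.

Lemma card_real_le (R : realType) : [set: R] #<= [set: set nat].
Proof.
apply: card_le_trans (card_set_countType rat).
apply: (@injective_card_le _ _ (fun x : R => [set q | ratr q < x])).
move=> x y e; apply: lt_rat_inj => q.
by have /= -> := congr1 (fun X : set rat => X q) e.
Qed.

Section ternary.
Variable R : realType.

(** Partial sums of the number whose base 3 digits are the indicator of [X].
    Base 3 leaves a gap that base 2 does not: changing the digit of rank [n]
    from 0 to 1 adds more than all the later digits together, so that distinct
    digit sequences give distinct numbers. *)
Definition ternary_sum (X : set nat) (n : nat) : R :=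
  \sum_(i < n) (\1_X (i : nat) * 3%:R ^- i).

Lemma ternary_sumS X n :
  ternary_sum X n.+1 = ternary_sum X n + \1_X n * 3%:R ^- n.
Proof. by rewrite /ternary_sum big_ord_recr. Qed.

Lemma indic01 (X : set nat) n : (0 <= \1_X n :> R) && (\1_X n <= 1 :> R).
Proof. by rewrite indicE; case: (n \in X) => /=; rewrite ?lexx ler01. Qed.

Lemma ternary_sum_le X m n : (m <= n)%N -> ternary_sum X m <= ternary_sum X n.
Proof.
elim: n => [|n IHn]; first by rewrite leqn0 => /eqP->.
rewrite leq_eqVlt => /predU1P[-> //|/IHn /le_trans]; apply.
by rewrite ternary_sumS lerDl mulr_ge0 ?invr_ge0 ?exprn_ge0.
Qed.

(** The digits after rank [m] contribute at most the geometric tail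
    [3 / 2 * 3 ^- m], so adding this tail to the partial sums gives decreasing
    upper bounds of the limit. *)
Lemma ternary_tail X m n : (m <= n)%N ->
  ternary_sum X n + 3%:R / 2%:R * 3%:R ^- n <=
  ternary_sum X m + 3%:R / 2%:R * 3%:R ^- m.
Proof.
elim: n => [|n IHn]; first by rewrite leqn0 => /eqP->.
rewrite leq_eqVlt => /predU1P[-> //|/IHn]; apply: le_trans.
rewrite ternary_sumS exprS invfM.
have : 0 < 3%:R ^- n :> R by rewrite invr_gt0 exprn_gt0.
have /andP[_] := indic01 X n.
move: (\1_X n) (3%:R ^- n) (ternary_sum X n) => i t s i1 t0.
have : i * t <= t by rewrite ler_piMl// ltW.
lra.
Qed.

Definition ternary (X : set nat) : R := sup (range (ternary_sum X)).

Lemma ternary_has_sup X : has_sup (range (ternary_sum X)).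
Proof.
split; first by exists (ternary_sum X 0); exists 0%N.
exists (ternary_sum X 0 + 3%:R / 2%:R * 3%:R ^- 0) => _ [n _ <-].
apply: le_trans (ternary_tail X (leq0n n)).
by rewrite lerDl mulr_ge0 ?invr_ge0 ?exprn_ge0.
Qed.

Lemma ternary_bounds X n :
  ternary_sum X n <= ternary X <= ternary_sum X n + 3%:R / 2%:R * 3%:R ^- n.
Proof.
apply/andP; split.
  by apply: sup_ubound; [case: (ternary_has_sup X) | exists n].
apply: sup_le_ub; first by case: (ternary_has_sup X).
move=> _ [m _ <-]; have [mn|/ltnW nm] := leqP m n.
  by rewrite (le_trans (ternary_sum_le X mn))// lerDl mulr_ge0 ?invr_ge0 ?exprn_ge0.
apply: le_trans (ternary_tail X nm).
by rewrite lerDl mulr_ge0 ?invr_ge0 ?exprn_ge0.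
Qed.

Lemma ternary_lt X Y n : (forall i, (i < n)%N -> (i \in X) = (i \in Y)) ->
  n \notin X -> n \in Y -> ternary X < ternary Y.
Proof.
move=> eXY nX nY.
have es : ternary_sum X n = ternary_sum Y n.
  by apply: eq_bigr => i _; rewrite !indicE eXY.
have /andP[_] := ternary_bounds X n.+1.
have /andP[+ _] := ternary_bounds Y n.+1.
rewrite !ternary_sumS !indicE nY (negbTE nX) es /= exprS invfM.
have : 0 < 3%:R ^- n :> R by rewrite invr_gt0 exprn_gt0.
by move: (3%:R ^- n) (ternary_sum Y n) => t s; lra.
Qed.

Lemma ternary_inj : injective ternary.
Proof.
move=> X Y eXY; apply/seteqP; suff e : forall n, (n \in X) = (n \in Y).
  by split=> n /mem_set; rewrite ?e => nX; apply/set_mem; rewrite ?e.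
move=> n; elim/ltn_ind: n => n IHn.
have [nX|nX] := boolP (n \in X); have [nY|nY] := boolP (n \in Y) => //.
  by have := @ternary_lt Y X n (fun i h => esym (IHn i h)) nY nX; rewrite eXY ltxx.
by have := ternary_lt IHn nX nY; rewrite eXY ltxx.
Qed.

End ternary.

Lemma card_real_ge (R : realType) : [set: set nat] #<= [set: R].
Proof. exact: injective_card_le (@ternary_inj R). Qed.

(** * Counting classes of continuum cardinality *)

(** Koenig's argument: if for each [c] some value [g c] were missed by
    [q |-> F q c c], then [g] itself would be missed by [F]. *)
Lemma konig_diagonal (Q C S : Type) (F : Q -> C -> (C -> S)) :
  (forall g, exists q c, F q c = g) ->
  exists c, forall s, exists q, F q c c = s.
Proof.
move=> F_surj; apply/not_existsP => noc.
have /choice[g gP] : forall c, exists s, forall q, F q c c <> s.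
  move=> c; have /existsNP[s /forallNP sP] := noc c.
  by exists s.
by have [q [c Fg]] := F_surj g; apply: (gP c q); rewrite Fg.
Qed.

(** Call the subsets of [nat] codes.  The pairs of a class and a code enumerate
    [T], hence also all functions from codes to sets of codes, because these
    functions are no more numerous than the points of [T].  By [konig_diagonal],
    once a suitable code is fixed, the classes alone enumerate all sets of
    codes. *)
Lemma small_classes (T : Type) (cls : T -> set T) :
  (forall x, cls x x) ->
  (forall x, exists e : set nat -> T, cls x `<=` range e) ->
  [set: set (set nat)] #<= [set: T] ->
  [set: set (set nat)] #<= range cls.
Proof.
move=> cls_refl cls_small.
have [[t0]|noT] := pselect (inhabited T); last first.
  move=> /card_leP[f]; exfalso.
  have := f (SigSub (mem_set (I : [set: set (set nat)] set0))).
  by case=> t _; exact: noT.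
move=> /(card_le_injective t0)[j j_inj].
have /(card_le_injective set0)[p p_inj] :=
  card_prod_set_nat (card_lexx [set: set nat]) (card_lexx [set: set nat]).
have /choice[e eP] : forall q : range cls,
    exists e : set nat -> T, val q `<=` range e.
  by case=> q /= /set_mem[x _ <-]; exact: cls_small.
(* [D t c] is the section at [c] of the set of pairs that [t] encodes. *)
pose D (t : T) (c : set nat) : set (set nat) :=
  [set d | exists2 X, j X = t & X (p (c, d))].
have D_surj g : exists t, D t = g.
  exists (j [set z | exists c d, z = p (c, d) /\ g c d]).
  apply/funext => c; apply/seteqP; split=> d.
    by move=> [X /j_inj -> [c' [d' [/p_inj[-> ->]]]]].
  by move=> gcd; exists [set z | exists c d, z = p (c, d) /\ g c d] => //; exists c, d.
have [c cP] : exists c, forall s, exists q, D (e q c) c = s.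
  apply: (@konig_diagonal _ _ _ (fun q c => D (e q c))) => g.
  have [t <-] := D_surj g.
  have q_in : cls t \in range cls by apply/mem_set; exists t.
  have [c _ ec] := eP (SigSub q_in) t (cls_refl t).
  by exists (SigSub q_in), c; rewrite ec.
have /choice[k kP] := cP.
have : $|{injfun [set: set (set nat)] >-> range cls}|.
  apply/injfunPex; exists (fun s => val (k s)).
    by move=> s _; exact: set_mem (valP (k s)).
  by move=> s s' _ _ /val_inj ek; rewrite -[s]kP ek kP.
by move=> [f]; exact: inj_card_le f.
Qed.

(** * Separation and countability in the Pruefer plane *)

Lemma continuous_open_preimage (S T : topologicalType) (f : S -> T) (V : set T) :
  continuous f -> open V -> open (f @^-1` V).
Proof. by move=> /continuousP; exact. Qed.

Lemma countable_setU (T : Type) (X Y : set T) :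
  countable X -> countable Y -> countable (X `|` Y).
Proof.
by move=> cX cY; rewrite -bigcup2E; apply: bigcup_countable => // -[|[|n]].
Qed.

Section prufer_plane.
Variable R : realType.
Implicit Types (a b x y t d : R) (p : R * R) (z : prufer R) (A B : set R).

Variant prufer_chart_spec a p : prufer R -> Prop :=
| ChartUpper (y_gt0 : 0 < p.2) :
    prufer_chart_spec a p (Upper (a + p.1 * p.2) y_gt0)
| ChartLower (y_le0 : p.2 <= 0) : prufer_chart_spec a p (Lower a p.1 y_le0).

Lemma prufer_chartP a p : prufer_chart_spec a p (prufer_chart a p).
Proof. by rewrite /prufer_chart; case: (ltP 0 p.2) => y0; constructor. Qed.

Definition lower_half b : set (prufer R) :=
  [set z | if z is Lower a _ _ _ then a = b else False].

Definition open_lower_half b : set (prufer R) :=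
  [set z | if z is Lower a _ y _ then a = b /\ y < 0 else False].

(** In the chart of index [b] the condition on a point of [U] reads
    [`|x * y| < d], which holds near every point with [y = 0]: for [0 < d] this
    is a neighbourhood of [L_b]. *)
Definition strip b d : set (prufer R) :=
  [set z | match z with Upper x _ _ => `|x - b| < d | Lower a _ _ _ => a = b end].

Lemma continuous_fst : continuous (@fst R R).
Proof. by case=> x y; exact: cvg_fst. Qed.

Lemma continuous_snd : continuous (@snd R R).
Proof. by case=> x y; exact: cvg_snd. Qed.

Lemma open_sublevel (f : R * R -> R) : continuous f -> open [set p | f p < 0].
Proof.
move=> /continuousP cf; rewrite -[[set p | _]]/(f @^-1` [set x | x < 0]).
exact/cf/open_lt.
Qed.

Lemma open_prufer_chart (V : set (prufer R)) :
  (forall a, open (prufer_chart a @^-1` V)) -> open V.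
Proof. by []. Qed.

Lemma continuous_prufer_chart a : continuous (@prufer_chart R a).
Proof. by apply/continuousP => V; apply. Qed.

Lemma open_open_lower_half b : open (open_lower_half b).
Proof.
apply: open_prufer_chart => a; have [<-{b}|ab] := pselect (a = b).
  rewrite (_ : _ @^-1` _ = [set p | p.2 < 0]); last first.
    apply/seteqP; split=> p /=; case: prufer_chartP => //= y0.
      by case.
    by rewrite ltNge (ltW y0).
  exact/open_sublevel/continuous_snd.
rewrite (_ : _ @^-1` _ = set0); first exact: open0.
by apply/seteqP; split=> p //=; case: prufer_chartP => //= _ [].
Qed.

Lemma closed_lower_half b : closed (lower_half b).
Proof.
rewrite -openC; apply: open_prufer_chart => a.
have [<-{b}|ab] := pselect (a = b).
  rewrite (_ : _ @^-1` _ = [set p | - p.2 < 0]); last first.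
    apply/seteqP; split=> p /=; rewrite oppr_lt0; case: prufer_chartP => //= y0.
      by move=> _ [].
    by rewrite ltNge y0.
  by apply: open_sublevel => p; apply: cvgN; exact: continuous_snd.
rewrite (_ : _ @^-1` _ = setT); first exact: openT.
by apply/seteqP; split=> p //= _; case: prufer_chartP => /= _ //; case.
Qed.

Lemma open_strip b d : 0 < d -> open (strip b d).
Proof.
move=> d0; apply: open_prufer_chart => a; have [<-{b}|ab] := pselect (a = b).
  (* The factor [max p.2 0] vanishes on the lower half plane, which lies
     entirely in the strip. *)
  rewrite (_ : _ @^-1` _ = [set p | `|p.1 * Num.max p.2 0| - d < 0]); last first.
    apply/seteqP; split=> p /=; rewrite subr_lt0; case: prufer_chartP => //= y0.
    - by rewrite addrAC subrr add0r max_l// ltW.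
    - by rewrite max_r// mulr0 normr0.
    - by rewrite addrAC subrr add0r max_l// ltW.
  apply: open_sublevel => p; apply: cvgB; last exact: cvg_cst.
  apply: cvg_norm; apply: cvgM; first exact: continuous_fst.
  apply: (@continuous_max _ _ snd (cst 0)); first exact: continuous_snd.
  exact: cst_continuous.
rewrite (_ : _ @^-1` _ =
  [set p | - p.2 < 0] `&` [set p | `|a + p.1 * p.2 - b| - d < 0]); last first.
  apply/seteqP; split=> p /=; rewrite subr_lt0 oppr_lt0; case: prufer_chartP => //= y0.
    by case.
  by case=> /lt_geF; rewrite y0.
apply: openI.
  by apply: open_sublevel => p; apply: cvgN; exact: continuous_snd.
apply: open_sublevel => p; apply: cvgB; last exact: cvg_cst.
apply: cvg_norm; apply: cvgB; last exact: cvg_cst.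
apply: cvgD; first exact: cvg_cst.
by apply: cvgM; [exact: continuous_fst | exact: continuous_snd].
Qed.

(** Strips of half width at most half the distance of [b] and [b'] cannot share
    a point of [U]. *)
Lemma strip_disjoint b b' : b <> b' -> exists2 d, 0 < d &
  strip b d `&` strip b' d = set0.
Proof.
move=> /eqP; rewrite -subr_eq0 -normr_gt0 => bb'.
exists (`|b - b'| / 2); first by rewrite divr_gt0.
apply/seteqP; split=> // -[x y y0|a x y y0] [] /=.
  by move=> xb xb'; have := ler_distD x b b'; rewrite (distrC b x); lra.
by move=> -> eb; move: bb'; rewrite eb subrr normr0 ltxx.
Qed.

Lemma rat_dense_plane (V : set (R * R)) p : open V -> V p ->
  exists q : rat * rat, V (ratr q.1, ratr q.2).
Proof.
move=> oV Vp; have : nbhs p V by exact: open_nbhs_nbhs.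
move=> [[X Y] /= [nX nY] XYV].
have rat_in (W : set R) x : nbhs x W -> exists q : rat, W (ratr q).
  move=> /nbhs_ballP[e /= e0 eW].
  have [|r [/eW Wr [q _ qr]]] := @dense_rat R (ball x e) _ (ball_open x e).
    by exists x; exact: ballxx.
  by exists q; rewrite qr.
have [q1 Xq] := rat_in _ _ nX; have [q2 Yq] := rat_in _ _ nY.
by exists (q1, q2); apply: XYV; split.
Qed.

(** The plane is separable and the interiors of the lower half planes are
    disjoint open sets, so each that meets the image of [phi] contains the image
    of a rational point, and this point determines it. *)
Lemma countable_open_lower_half (phi : R * R -> prufer R) : continuous phi ->
  countable [set b | exists p, open_lower_half b (phi p)].
Proof.
move=> /continuousP cphi.
pose f (q : rat * rat) : R :=
  if phi (ratr q.1, ratr q.2) is Lower a _ _ _ then a else 0.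
apply: (@sub_countable _ _ _ (f @` setT)); last first.
  by apply: sub_countable (card_image_le _ _) _.
apply: subset_card_le => b [p pb].
have [q] := @rat_dense_plane (phi @^-1` open_lower_half b) p
  (cphi _ (@open_open_lower_half b)) pb.
rewrite /= /open_lower_half /= => qb; exists q => //.
by move: qb; rewrite /f; case: (phi _) => // ? ? ? ? [].
Qed.

(** On the ray [t < 0] the preimage of the interior of [L_b] is open, and it is
    also closed because it coincides there with the preimage of the closed set
    [L_b].  So it is the whole ray, and the end point goes to [L_b]. *)
Lemma ray_lower_half (phi : R -> prufer R) b y : continuous phi ->
  (forall t, t < 0 -> exists b', open_lower_half b' (phi t)) ->
  y < 0 -> open_lower_half b (phi y) -> lower_half b (phi 0).
Proof.
move=> /[dup] cphi' /continuousP cphi phi_low y0 yb.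
have oint : forall t, t < 0 -> lower_half b (phi t) -> open_lower_half b (phi t).
  by move=> t /phi_low[b']; case: (phi t) => //= ? ? ? ? [-> ?] ->.
have cL : closed (phi @^-1` lower_half b).
  by apply: closed_comp => [t _|]; [exact: cphi' | exact: closed_lower_half].
have conn : connected [set` `]-oo, (0 : R)[].
  exact/connected_intervalP/interval_is_interval.
have /seteqP[_ all_low] : [set` `]-oo, (0 : R)[] `&`
    phi @^-1` open_lower_half b = [set` `]-oo, (0 : R)[].
  apply: conn.
  - by exists y; split => //=; rewrite in_itv.
  - by exists (phi @^-1` open_lower_half b) => //; apply: cphi; exact: open_open_lower_half.
  - exists (phi @^-1` lower_half b) => //; apply/seteqP.
    split=> t /= []; rewrite in_itv /= => t0 bt; split=> //; last exact: oint.
    by move: bt; case: (phi t) => //= ? ? ? ? [].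
apply: cL => N /nbhs_ballP[e /= e0 eN].
exists (- (e / 2)); split.
  have /all_low[_] : [set` `]-oo, (0 : R)[] (- (e / 2)).
    by rewrite /= in_itv /= oppr_lt0 divr_gt0.
  by rewrite /=; case: (phi _) => //= ? ? ? ? [].
apply: eN; rewrite /ball /= opprK add0r ger0_norm ?divr_ge0 ?(ltW e0)//.
by rewrite ltr_pdivrMr// ltr_pMr// ltr1n.
Qed.

(** * Homeomorphisms between the subspaces P_A *)

Lemma continuous_pair (T : topologicalType) (f f' : T -> R) :
  continuous f -> continuous f' -> continuous (fun u => (f u, f' u)).
Proof. by move=> cf cf' u; exact: cvg_pair (cf u) (cf' u). Qed.

Lemma prufer_subE A z :
  prufer_sub A z <-> if z is Lower a _ _ _ then A a else True.
Proof.
case: z => [x y y0|a x y y0]; split=> //.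
- by move=> _; left; exists x, y, y0.
- by case=> [[? [? [? //]]]|[b Ab [? [? [? [-> _ _]]]]]].
- by move=> Aa; right; exists a => //; exists x, y, y0.
Qed.

Lemma prufer_chart_sub A a (Aa : A a) p : prufer_chart a p \in prufer_sub A.
Proof. by apply/mem_set/prufer_subE; case: prufer_chartP. Qed.

Lemma prufer_chart_exp_sub A p :
  prufer_chart 0 (p.1, expR p.2) \in prufer_sub A.
Proof.
apply/mem_set/prufer_subE; case: prufer_chartP => //= y0.
by have := expR_gt0 p.2; rewrite ltNge y0.
Qed.

Definition sub_chart A a (Aa : A a) p : prufer_sub A :=
  exist _ (prufer_chart a p) (prufer_chart_sub Aa p).

(** A parametrization of [U] by the whole plane, so that statements about
    continuous images of the plane apply to [U]; it exists also when [A] is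
    empty. *)
Definition upper_chart A p : prufer_sub A :=
  exist _ (prufer_chart 0 (p.1, expR p.2)) (prufer_chart_exp_sub A p).

Lemma continuous_sub_chart A a (Aa : A a) : continuous (sub_chart Aa).
Proof. exact/continuous_comp_initial/continuous_prufer_chart. Qed.

Lemma continuous_sub_val A : continuous (val : prufer_sub A -> prufer R).
Proof. exact: initial_continuous. Qed.

Lemma continuous_upper_chart A : continuous (upper_chart A).
Proof.
apply: continuous_comp_initial => p.
apply: (@continuous_comp _ _ _ (fun p : R * R => (p.1, expR p.2)));
  last exact: continuous_prufer_chart.
apply: continuous_pair p; first exact: continuous_fst.
by move=> p; apply: continuous_comp; [exact: continuous_snd | exact: continuous_expR].
Qed.

Lemma upper_chartP A (z : prufer_sub A) x y (y0 : 0 < y) :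
  val z = Upper x y0 -> exists p, z = upper_chart A p.
Proof.
move=> zE; exists (x / y, ln y); apply/val_inj; rewrite zE /= lnK ?posrE//.
by rewrite prufer_chart_gt0; move: (y0); rewrite -{1}[x](divfK (lt0r_neq0 y0)) add0r.
Qed.

Lemma sub_chartP A (z : prufer_sub A) a x y (y0 : y <= 0) :
  val z = Lower a x y0 -> exists Aa : A a, z = sub_chart Aa (x, y).
Proof.
move=> zE; have Aa : A a by have /set_mem /prufer_subE := valP z; rewrite zE.
by exists Aa; apply/val_inj; rewrite zE /= prufer_chart_le0.
Qed.

(** The point [(x, 0)] of [L_a] is the limit of the points of [U] with chart
    coordinates [(x, e)], for [e > 0]. *)
Lemma boundary_near_upper A a (Aa : A a) x (V : set (prufer_sub A)) :
  open V -> V (sub_chart Aa (x, 0)) -> exists p, V (upper_chart A p).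
Proof.
move=> oV Vx; have oW := continuous_open_preimage (@continuous_sub_chart A a Aa) oV.
have : nbhs (x, 0 : R) (sub_chart Aa @^-1` V) by exact: open_nbhs_nbhs.
move=> [[X Y] /= [/nbhs_singleton Xx /nbhs_ballP[e /= e0 eY]] XYV].
have e2 : 0 < e / 2 by rewrite divr_gt0.
have Ve : V (sub_chart Aa (x, e / 2)).
  apply: XYV; split => //=; apply: eY.
  by rewrite /ball /= sub0r normrN gtr0_norm// ltr_pdivrMr// ltr_pMr// ltr1n.
have [|p pE] := @upper_chartP _ (sub_chart Aa (x, e / 2)) (a + x * (e / 2)) _ e2.
  exact: prufer_chart_gt0.
by exists p; rewrite -pE.
Qed.

Section homeomorphism.
Variables (A B : set R).
Variables (h : prufer_sub A -> prufer_sub B) (g : prufer_sub B -> prufer_sub A).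
Hypotheses (hK : cancel h g) (ch : continuous h) (cg : continuous g).

(** The image under [h] of the interior of [L_a] is open.  If it avoids [U], it
    also avoids the boundaries of the lower half planes, since these lie in the
    closure of [U]. *)
Lemma image_open_lower_half a (Aa : A a) :
  (forall p, ~ open_lower_half a (val (g (upper_chart B p)))) ->
  forall x y, y < 0 -> exists b, open_lower_half b (val (h (sub_chart Aa (x, y)))).
Proof.
move=> noU x y y0; have : open_lower_half a (val (g (h (sub_chart Aa (x, y))))).
  by rewrite hK /= (prufer_chart_le0 _ _ (ltW y0)).
move: (h _) => z gz; case E : (val z) => [u v v0|b u v v0].
  by have [p zE] := upper_chartP E; case: (noU p); rewrite -zE.
exists b; split=> //; rewrite lt_neqAle v0 andbT; apply/eqP => v_eq0.
subst v; have [Bb zE] := sub_chartP E; rewrite zE in gz.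
have oV : open ((fun w => val (g w)) @^-1` open_lower_half a).
  apply: continuous_open_preimage; last exact: open_open_lower_half.
  by move=> w; apply: continuous_comp; [exact: cg | exact: continuous_sub_val].
by have [p] := boundary_near_upper oV gz; exact: noU.
Qed.

(** The vertical ray of [L_a] through the given point is mapped into the
    interiors of lower half planes, hence into a single one. *)
Lemma image_boundary a (Aa : A a) x y b :
  (forall p, ~ open_lower_half a (val (g (upper_chart B p)))) ->
  y < 0 -> open_lower_half b (val (h (sub_chart Aa (x, y)))) ->
  lower_half b (val (h (sub_chart Aa (x, 0)))).
Proof.
move=> noU y0.
apply: (@ray_lower_half (fun t => val (h (sub_chart Aa (x, t)))) b y) => //.
  move=> t; apply: continuous_comp; last exact: continuous_sub_val.
  apply: continuous_comp; last exact: ch.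
  apply: (@continuous_comp _ _ _ (fun t => (x, t)));
    last exact: continuous_sub_chart.
  by apply: continuous_pair t => t; [exact: cvg_cst | exact: cvg_id].
by move=> t; exact: image_open_lower_half.
Qed.

End homeomorphism.

(** The exceptional indices [b] are those for which the preimage of the interior
    of [L_b] meets [U] or one of the countably many [L_a] such that the interior
    of [L_a] has points sent to [U] by [h] or by [h']. *)
Lemma homeomorphic_diff_countable A B B'
  (h : prufer_sub A -> prufer_sub B) (g : prufer_sub B -> prufer_sub A)
  (h' : prufer_sub A -> prufer_sub B') (g' : prufer_sub B' -> prufer_sub A) :
  cancel h g -> cancel g h -> continuous h -> continuous g ->
  cancel h' g' -> continuous h' -> continuous g' ->
  (forall q : rat * rat, val (h (upper_chart A (ratr q.1, ratr q.2))) =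
                         val (h' (upper_chart A (ratr q.1, ratr q.2)))) ->
  countable (B `\` B').
Proof.
move=> hK gK ch cg h'K ch' cg' hh'.
pose badA C (k : prufer_sub C -> prufer_sub A) :=
  [set a | exists p, open_lower_half a (val (k (upper_chart C p)))].
have badA_countable C (k : prufer_sub C -> prufer_sub A) :
    continuous k -> countable (badA C k).
  move=> ck; apply: (@countable_open_lower_half (fun p => val (k (upper_chart C p)))).
  move=> p; apply: continuous_comp; last exact: continuous_sub_val.
  by apply: continuous_comp; [exact: continuous_upper_chart | exact: ck].
pose badA2 := badA B g `|` badA B' g'.
pose badB := [set b | exists p, open_lower_half b (val (h (upper_chart A p)))] `|`
  \bigcup_(a in badA2)
    [set b | exists (Aa : A a) p, open_lower_half b (val (h (sub_chart Aa p)))].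
have badB_countable : countable badB.
  have chv : continuous (fun w => val (h w)).
    by move=> w; apply: continuous_comp; [exact: ch | exact: continuous_sub_val].
  apply: countable_setU.
    apply: (@countable_open_lower_half (fun p => val (h (upper_chart A p)))).
    move=> p; apply: (@continuous_comp _ _ _ (upper_chart A) (fun w => val (h w))).
      exact: continuous_upper_chart.
    exact: chv.
  apply: bigcup_countable; first by apply: countable_setU; exact: badA_countable.
  move=> a _; have [Aa|nAa] := pselect (A a); last first.
    rewrite (_ : [set b | _] = set0)//.
    by apply/seteqP; split=> // b [Aa].
  rewrite (_ : [set b | _] =
    [set b | exists p, open_lower_half b (val (h (sub_chart Aa p)))]); last first.
    apply/seteqP; split=> b.
      by case=> Aa'; rewrite (Prop_irrelevance Aa' Aa).
    by exists Aa.
  apply: (@countable_open_lower_half (fun p => val (h (sub_chart Aa p)))).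
  move=> p; apply: (@continuous_comp _ _ _ (sub_chart Aa) (fun w => val (h w))).
    exact: continuous_sub_chart.
  exact: chv.
apply: sub_countable badB_countable; apply: subset_card_le => b [Bb nB'b].
apply: contrapT => good_b; apply: nB'b.
have N1 : (-1 : R) < 0 by rewrite oppr_lt0.
pose w : prufer_sub B := sub_chart Bb (0, -1).
have low_b : open_lower_half b (val (h (g w))).
  by rewrite gK /= (prufer_chart_le0 _ _ (ltW N1)).
have [a wa] : exists a, open_lower_half a (val (g w)).
  apply: (image_open_lower_half gK) => //.
  by move=> p bp; apply: good_b; left; exists p.
case E : (val (g w)) wa => [//|a' x y y0'] [ea y0]; subst a'.
have [Aa gwE] := sub_chartP E; rewrite gwE in low_b.
have good_a : ~ badA2 a.
  by move=> ba; apply: good_b; right; exists a => //; exists Aa, (x, y).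
have good_ag p : ~ open_lower_half a (val (g (upper_chart B p))).
  by move=> ap; apply: good_a; left; exists p.
have good_ag' p : ~ open_lower_half a (val (g' (upper_chart B' p))).
  by move=> ap; apply: good_a; right; exists p.
have hq := image_boundary hK ch cg good_ag y0 low_b.
have [b' low_b'] := image_open_lower_half h'K cg' Aa good_ag' x y0.
have h'q := image_boundary h'K ch' cg' good_ag' y0 low_b'.
have B'b' : B' b'.
  have /set_mem/prufer_subE := valP (h' (sub_chart Aa (x, y))).
  by move: low_b'; case: (val _) => //= ? ? ? ? [->].
have [->//|bb'] := pselect (b = b').
have [d d0 dis] := strip_disjoint bb'.
have strip_lower c z : lower_half c z -> strip c d z by case: z.
(* As [b] and [b'] are distinct here, some point of [U] with rational
   coordinates in [upper_chart A], close to the boundary point [(x, 0)] of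
   [L_a], has its common image in both strips. *)
pose V := (fun w => val (h w)) @^-1` strip b d `&`
          (fun w => val (h' w)) @^-1` strip b' d.
have oV : open V.
  apply: openI.
    apply: continuous_open_preimage; last exact: open_strip.
    by move=> z; apply: continuous_comp; [exact: ch | exact: continuous_sub_val].
  apply: continuous_open_preimage; last exact: open_strip.
  by move=> z; apply: continuous_comp; [exact: ch' | exact: continuous_sub_val].
have [p Vp] : exists p, V (upper_chart A p).
  by apply: (@boundary_near_upper _ _ Aa x) => //; split; exact: strip_lower.
have oVp := continuous_open_preimage (@continuous_upper_chart A) oV.
have [q [/= qb qb']] := rat_dense_plane oVp Vp.
have : (strip b d `&` strip b' d) (val (h (upper_chart A (ratr q.1, ratr q.2)))).
  by split=> //; rewrite hh'.
by rewrite dis.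
Qed.

End prufer_plane.

(** * The size of a homeomorphism class *)

(** A countable set with an injective numbering [f] is encoded by the lower cut
    of each element [x], stored at the index [f x]; an index without element
    carries the empty set, which is no cut and so decodes to nothing. *)
Definition decode_countable (R : realType) (c : set (nat * rat)) : set R :=
  [set x | exists n, forall q, c (n, q) <-> ratr q < x].

Lemma decode_countable_surj (R : realType) (X : set R) : countable X ->
  exists c, decode_countable c = X :> set R.
Proof.
move=> /countable_injP[f f_inj].
exists [set z | exists x, [/\ X x, f x = z.1 & ratr z.2 < x]].
apply/seteqP; split=> x.
  move=> [n nP].
  (* The cut at index [n] is not empty, so [n] is the number of an element. *)
  have [q] : exists q : rat, q \in [set q : rat | ratr q < x].
    have /rat_in_itvoo[q] : x - 1 < x by rewrite ltrBlDr ltrDl.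
    by rewrite in_itv /= => /andP[_ qx]; exists q; apply/mem_set.
  move=> /set_mem /= /nP[y [Xy fy _]].
  suff -> : x = y by [].
  apply: lt_rat_inj => r; split=> [/nP[y' [Xy' fy' ry']]|ry].
    by rewrite -(f_inj y' y) ?inE // fy fy'.
  by apply/nP; exists y.
move=> Xx; exists (f x) => q; split=> [[y [/= Xy fy]]|qx]; last by exists x.
by rewrite -(f_inj y x) ?inE.
Qed.

Lemma card_prufer_le (R : realType) : [set: prufer R] #<= [set: set nat].
Proof.
(* The sign of the second real number tells the two kinds of points apart. *)
pose f (z : prufer R) : R * (R * R) :=
  match z with Upper x y _ => (x, (y, 0)) | Lower a x y _ => (a, (y, x)) end.
apply: (@card_le_trans _ _ _ [set: R * (R * R)]); last first.
  by do 2?[apply: card_prod_set_nat => //]; exact: card_real_le.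
apply: (@injective_card_le _ _ f) => -[x y y0|a x y y0] [x' y' y0'|a' x' y' y0'] /= [].
- by move=> ex ey; subst x' y'; rewrite (bool_irrelevance y0 y0').
- by move=> _ ey _; exfalso; have := y0'; rewrite -ey leNgt y0.
- by move=> _ ey _; exfalso; have := y0; rewrite ey leNgt y0'.
- by move=> ea ey ex; subst a' x' y'; rewrite (bool_irrelevance y0 y0').
Qed.

(** A member [B] of the class of [A] is encoded by the trace [v] of a homeomorphism
    from [P_A] to [P_B] on the points of [U] with rational coordinates in
    [upper_chart A], and by the two countable differences between [B] and a representative [rep v] chosen among
    the index sets that admit the trace [v]. *)
Lemma prufer_class_small (R : realType) (A : set R) :
  exists e : set nat -> set R, prufer_class A `<=` range e.
Proof.
pose trace (v : rat * rat -> prufer R) (B : set R) :=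
  exists (h : prufer_sub A -> prufer_sub B) (g : prufer_sub B -> prufer_sub A),
  [/\ cancel h g, cancel g h, continuous h, continuous g &
      forall q, v q = val (h (upper_chart A (ratr q.1, ratr q.2)))].
have /choice[rep repP] : forall v, exists B, (exists B', trace v B') -> trace v B.
  move=> v; have [[B vB]|noB] := pselect (exists B', trace v B').
    by exists B.
  by exists set0.
pose K := ((rat * rat -> prufer R) * (set (nat * rat) * set (nat * rat)))%type.
have /(card_le_injective set0)[i i_inj] : [set: K] #<= [set: set nat].
  apply: card_prod_set_nat.
    exact: card_fun_countType (card_prufer_le R).
  by apply: card_prod_set_nat; exact: card_set_countType.
pose e0 (k : K) : set R :=
  (rep k.1 `\` decode_countable k.2.1) `|` decode_countable k.2.2.
have /choice[e eP] : forall n, exists X, forall k, i k = n -> e0 k = X.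
  move=> n; have [[k <-]|nok] := pselect (exists k, i k = n).
    by exists (e0 k) => k' /i_inj ->.
  by exists set0 => k ik; case: nok; exists k.
exists e => B [h [g [hK gK ch cg]]].
pose v (q : rat * rat) := val (h (upper_chart A (ratr q.1, ratr q.2))).
have vB : trace v B by exists h, g.
have [h' [g' [h'K g'K ch' cg' vh']]] := repP v (ex_intro _ B vB).
have [c1 c1E] : exists c, decode_countable c = rep v `\` B.
  apply: decode_countable_surj.
  by apply: (homeomorphic_diff_countable h'K g'K ch' cg' hK ch cg) => q; rewrite -vh'.
have [c2 c2E] : exists c, decode_countable c = B `\` rep v.
  apply: decode_countable_surj.
  by apply: (homeomorphic_diff_countable hK gK ch cg h'K ch' cg') => q; rewrite -vh'.
exists (i (v, (c1, c2))) => //; rewrite -(eP _ (v, (c1, c2)) erefl) /e0 /= c1E c2E.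
by rewrite setDD setIC setUIDK.
Qed.

Lemma homeomorphic_refl (X : topologicalType) : homeomorphic X X.
Proof. by exists id, id; split=> // x; exact: cvg_id. Qed.

Theorem proposition4p1 (R : realType) :
  range (@prufer_class R) #= [set: set (set nat)].
Proof.
have [f f_inj] := card_le_injective 0 (card_real_ge R).
have [f' f'_inj] := card_le_injective set0 (card_real_le R).
apply: Cantor_Bernstein.
  apply: card_le_trans (card_image_le _ _) _.
  exact: card_powerset_le f'_inj.
apply: small_classes => [A|A|]; first exact: homeomorphic_refl.
  exact: prufer_class_small.
exact: card_powerset_le f_inj.
Qed.
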